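(* Let $\varepsilon>0$ be a fixed number, and suppose the objective $f:X\to\mathbb{R}$ satisfies the Lipschitz condition $|f(x)-f(y)|\le M_f\|x-y\|$ for all $x,y\in X$. Apply Algorithm A (described in the context) to the problem of minimizing $f(x)$ over $x\in X$ subject to $g_m(x)\le 0$ for all $m=1,\dots,M$, and suppose the stopping criterion of Algorithm A is satisfied. Then its output $\bar{x}^N$ is an $\varepsilon$-solution of the problem: $$f(\bar{x}^N)-f^*\le\varepsilon,\qquad g(\bar{x}^N)\le\varepsilon,$$ where $f^*=f(x_* )$ is the optimal value and $g(x)=\max_{1\le m\le M}g_m(x)$. Moreover, Algorithm A performs at most $$N=\left\lceil\frac{2\max\{M_f^2,M_g^2\}\,\Theta_0^2}{\varepsilon^2}\right\rceil$$ iterations.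
   Context: Setting. $(E,\|\cdot\|)$ is a finite-dimensional normed vector space, $E^*$ its dual with norm $\|y\|_*=\max\{\langle y,x\rangle:\|x\|\le1\}$, and $X\subset E$ is a closed convex set. The functions $f,g_1,\dots,g_M:X\to\mathbb{R}$ are convex and subdifferentiable, and there is a constant $M_g$ with $|g_m(x)-g_m(y)|\le M_g\|x-y\|$ for all $x,y\in X$ and all $m=1,\dots,M$. Put $g(x)=\max_{1\le m\le M}g_m(x)$. The problem is: minimize $f(x)$ over $x\in X$ subject to $g_m(x)\le0$ for all $m=1,\dots,M$. It is assumed to be solvable. Prox structure. $d:X\to\mathbb{R}$ is continuously differentiable and $1$-strongly convex with respect to $\|\cdot\|$, i.e. $\langle\nabla d(x)-\nabla d(y),x-y\rangle\ge\|x-y\|^2$ for all $x,y\in X$, and $\min_{x\in X}d(x)=d(0)$. The constant $\Theta_0>0$ satisfies $d(x_* )\le\Theta_0^2$, where $x_*$ is an exact solution of the problem (if there is a set $X_*$ of solutions, it is assumed that $\min_{x_*\in X_*}d(x_* )\le\Theta_0^2$). The Bregman divergence is $V(x,y)=d(y)-d(x)-\langle\nabla d(x),y-x\rangle$ and, for $x\in X$, $p\in E^*$, $$\mathrm{Mirr}_x(p)=\arg\min_{u\in X}\{\langle p,u\rangle+V(x,u)\},$$ which is assumed to be easily computable. Subgradients. $\nabla f(x)$ and $\nabla g_m(x)$ denote subgradients of $f$ and $g_m$ at $x$. All subgradients used in the algorithm are assumed nonzero (if $\nabla f(x^k)=0$, then $x^k$ already minimizes $f$ and the method is stopped). Algorithm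 A. Input: $\varepsilon>0$ and $\Theta_0$ with $d(x_* )\le\Theta_0^2$. Set $x^0=\arg\min_{x\in X}d(x)$, $I=\emptyset$, $N=0$. Repeat: - If $g(x^N)\le\varepsilon$ (productive step): set $M_N=\|\nabla f(x^N)\|_*$, $h_N=\varepsilon/M_N^2$, $x^{N+1}=\mathrm{Mirr}_{x^N}(h_N\nabla f(x^N))$, and add $N$ to $I$. - Otherwise (non-productive step): $g_{m(N)}(x^N)>\varepsilon$ for some $m(N)\in\{1,\dots,M\}$; take any such $m(N)$ and set $M_N=\|\nabla g_{m(N)}(x^N)\|_*$, $h_N=\varepsilon/M_N^2$, $x^{N+1}=\mathrm{Mirr}_{x^N}(h_N\nabla g_{m(N)}(x^N))$. - Replace $N$ by $N+1$. Stop as soon as $\sum_{j=0}^{N-1}\frac{1}{M_j^2}\ge\frac{2\Theta_0^2}{\varepsilon^2}$ (the stopping criterion). Output: $\bar{x}^N=\frac{\sum_{k\in I}h_kx^k}{\sum_{k\in I}h_k}$.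
   Formalization: Added: d(0) ≥ 0 (otherwise Θ₀ could be arbitrarily small); and, for the iteration bound only, subgradients used at iterates not in the interior of X have dual norm at most M_f (productive) or M_g (non-productive), since subgradients at boundary points can be arbitrarily long. *)

(* Defs.v *)
From HB Require Import structures.
From mathcomp Require Import all_boot all_order all_algebra.
From mathcomp Require Import all_classical all_reals all_analysis.

Set Implicit Arguments.
Unset Strict Implicit.
Unset Printing Implicit Defensive.

Import Order.TTheory GRing.Theory Num.Theory.
Import numFieldNormedType.Exports.

Local Open Scope classical_set_scope.
Local Open Scope ring_scope.

(* Finite-dimensional spaces carrying an arbitrary norm. *)
#[short(type="normedVectType")]
HB.structure Definition NormedVector (R : numFieldType) :=
  {E of NormedModule R E & Vector R E}.

(* In finite dimension every linear form is continuous, so E^* is the space of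
   all linear forms. *)
Definition dual (R : realType) (E : normedVectType R) := 'Hom(E, R^o).

Definition dual_norm (R : realType) (E : normedVectType R) (p : dual E) : R :=
  sup [set (p x : R) | x in [set x : E | `|x| <= 1]].

(* Functions on X are represented by total functions on E; only their values on
   X are ever constrained or used. *)

Definition is_argmin (R : realType) (E : normedVectType R)
    (X : set E) (phi : E -> R) (u : E) : Prop :=
  X u /\ forall v, X v -> phi u <= phi v.

Definition is_subgradient (R : realType) (E : normedVectType R)
    (X : set E) (phi : E -> R) (x : E) (p : dual E) : Prop :=
  forall y, X y -> phi x + p (y - x) <= phi y.

Definition subdifferentiable_on (R : realType) (E : normedVectType R)
    (X : set E) (phi : E -> R) : Prop :=
  forall x, X x -> exists p : dual E, is_subgradient X phi x p.

(* Differentiability is relative to X, so that boundary points of X (or an X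
   with empty interior) are covered.  Where the gradient is not unique, gd is
   any continuous choice of it. *)
Definition continuously_differentiable_on (R : realType)
    (E : normedVectType R) (X : set E) (d : E -> R) (gd : E -> dual E) : Prop :=
  (forall x, X x ->
     (fun y => d y - d x - gd x (y - x) : R^o)
       =o_ (within X (nbhs x)) (fun y => y - x)) /\
  (forall x, X x ->
     dual_norm (gd y - gd x) @[y --> within X (nbhs x)] --> (0 : R)).

Definition strongly_convex1_on (R : realType) (E : normedVectType R)
    (X : set E) (gd : E -> dual E) : Prop :=
  forall x y, X x -> X y -> `|x - y| ^+ 2 <= (gd x - gd y) (x - y).

Definition bregman (R : realType) (E : normedVectType R)
    (d : E -> R) (gd : E -> dual E) (x y : E) : R :=
  d y - d x - gd x (y - x).

(* u = Mirr_x(p) *)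
Definition is_mirr (R : realType) (E : normedVectType R)
    (X : set E) (d : E -> R) (gd : E -> dual E)
    (x : E) (p : dual E) (u : E) : Prop :=
  is_argmin X (fun v => p v + bregman d gd x v) u.

(* The M.+1 >= 1 constraints are indexed by 'I_M.+1. *)
Definition gmax (R : realType) (E : normedVectType R) (M : nat)
    (g : 'I_M.+1 -> E -> R) (x : E) : R :=
  \big[Num.max/g ord0 x]_(m < M.+1) g m x.

Definition is_solution (R : realType) (E : normedVectType R) (M : nat)
    (X : set E) (f : E -> R) (g : 'I_M.+1 -> E -> R) (xs : E) : Prop :=
  is_argmin (X `&` [set x | forall m, g m x <= 0]) f xs.

Definition productive (R : realType) (E : normedVectType R) (M : nat)
    (g : 'I_M.+1 -> E -> R) (eps : R) (x : E) : bool :=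
  gmax g x <= eps.

Definition step_size (R : realType) (E : normedVectType R)
    (eps : R) (p : dual E) : R :=
  eps / dual_norm p ^+ 2.

Definition stopping (R : realType) (E : normedVectType R)
    (eps Theta0 : R) (p : nat -> dual E) (N : nat) : Prop :=
  2 * Theta0 ^+ 2 / eps ^+ 2 <= \sum_(j < N) (dual_norm (p j) ^+ 2)^-1.

(* N iterations are performed: x k is the k-th point, p k the subgradient used
   at step k, m k the violated constraint selected at step k when that step is
   non-productive.  The choices of p k and m k are arbitrary; the stopping
   criterion holds at no index j < N and may or may not hold at N. *)
Record algorithm_run (R : realType) (E : normedVectType R) (M : nat)
    (X : set E) (d : E -> R) (gd : E -> dual E)
    (f : E -> R) (g : 'I_M.+1 -> E -> R) (eps Theta0 : R)
    (x : nat -> E) (p : nat -> dual E) (m : nat -> 'I_M.+1) (N : nat) : Prop :=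
  AlgorithmRun {
    run_start : is_argmin X d (x 0%N);
    run_productive : forall k, (k < N)%N -> productive g eps (x k) ->
      is_subgradient X f (x k) (p k);
    run_nonproductive : forall k, (k < N)%N -> ~~ productive g eps (x k) ->
      eps < g (m k) (x k) /\ is_subgradient X (g (m k)) (x k) (p k);
    run_nonzero : forall k, (k < N)%N -> p k != 0;
    run_step : forall k, (k < N)%N ->
      is_mirr X d gd (x k) (step_size eps (p k) *: p k) (x k.+1);
    run_continue : forall j, (j < N)%N -> ~ stopping eps Theta0 p j
  }.

Definition total_weight (R : realType) (E : normedVectType R) (M : nat)
    (g : 'I_M.+1 -> E -> R) (eps : R)
    (x : nat -> E) (p : nat -> dual E) (N : nat) : R :=
  \sum_(k < N | productive g eps (x k)) step_size eps (p k).

Definition output (R : realType) (E : normedVectType R) (M : nat)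
    (g : 'I_M.+1 -> E -> R) (eps : R)
    (x : nat -> E) (p : nat -> dual E) (N : nat) : E :=
  (total_weight g eps x p N)^-1 *:
    \sum_(k < N | productive g eps (x k)) step_size eps (p k) *: x k.

(* Main.v *)
Require Import Defs.
From mathcomp Require Import all_boot all_order all_algebra.
From mathcomp Require Import all_classical all_reals all_analysis.
From mathcomp Require Import ring lra.

Set Implicit Arguments.
Unset Strict Implicit.
Unset Printing Implicit Defensive.

Import Order.TTheory GRing.Theory Num.Theory.
Import numFieldNormedType.Exports.
Import VectorInternalTheory.

Local Open Scope classical_set_scope.
Local Open Scope ring_scope.

(** Write [|p|] for the dual norm and [V] for the Bregman divergence.  Let
    [w_k = eps / |p_k|^2] be the step sizes and [S_n] the sum of
    [1 / |p_k|^2] over [k < n].  The first-order optimality condition for the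
    mirror step, the quadratic lower bound [|u - x|^2 / 2 <= V(x, u)] and
    [<p, x - u> <= |p| |x - u|] give, for every [v] in [X],
      [w_k <p_k, x_k - v> <= eps^2 / (2 |p_k|^2) + V(x_k, v) - V(x_{k+1}, v)]
    ([mirror_step]).  Summing telescopes ([run_regret]).  With [v = xs] one has
    [V(x_0, xs) <= d(xs) <= Theta0^2], and the stopping criterion says that
    [Theta0^2 <= eps^2 S_N / 2]; hence
      [\sum_k w_k (<p_k, x_k - xs> - eps) <= 0]
    ([run_excess_le0]).  In this sum every non-productive step contributes a
    positive term, because [<p_k, x_k - xs> >= g_m(x_k) - g_m(xs) > eps].  So
    there is at least one productive step, and the weighted average of
    [f(x_k) - f(xs)] over the productive steps is at most [eps].  Jensen's
    inequality ([jensen]) carries this over to the output, as well as the bounds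
    [g_m(x_k) <= eps].

    For the iteration count, each [|p_k|] is at most [Mf] or [Mg]: at interior
    points this follows from the Lipschitz condition
    ([interior_lipschitz_dual_norm]), elsewhere it is a hypothesis.  Hence
    [S_n >= n / max(Mf^2, Mg^2)], and since the criterion fails at [N - 1], the
    number [N - 1] is smaller than the real number inside the ceiling.

    Two facts need finite dimension or calculus.  The supremum defining the dual
    norm is finite because a linear form is bounded, by compactness of the unit
    sphere of the coordinate space ([dual_bounded]).  The gradient of [d] is
    only relative to [X], so it is used along segments of [X], where it yields
    a derivative on [[0, 1]] in the sense of [unit_derivative]; the mean value
    theorem then gives the bound on the Bregman divergence ([bregman_ge]). *)

(** * The dual norm in finite dimension *)

Lemma rV_linear_bounded {R : realType} {V : normedModType R} n
    (h : {linear 'rV[R]_n -> V}) :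
  exists2 C : R, 0 <= C & forall v, `|h v| <= C * `|v|.
Proof.
exists (\sum_(i < n) `|h (delta_mx 0 i)|); first exact: sumr_ge0.
move=> v; rewrite {1}(row_sum_delta v) linear_sum mulr_suml.
apply: (le_trans (ler_norm_sum _ _ _)); apply: ler_sum => i _.
rewrite linearZ normrZ mulrC ler_wpM2l//.
rewrite [leRHS]mx_normrE; exact: (le_bigmax _ _ (0, i)).
Qed.

Lemma rV_linear_continuous {R : realType} {V : normedModType R} n
    (h : {linear 'rV[R]_n -> V}) : continuous h.
Proof.
apply/linear_bounded_continuous/linear_boundedP.
have [C C0 hC] := rV_linear_bounded h.
exists C; split; first exact: ger0_real.
by move=> r Cr v; apply: (le_trans (hC v)); rewrite ler_wpM2r// ltW.
Qed.

Lemma rV_linear_norm_continuous {R : realType} {V : normedModType R} n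
    (h : {linear 'rV[R]_n -> V}) : continuous (fun v => `|h v|).
Proof.
move=> v; apply: (@continuous_comp _ _ _ h); last exact: norm_continuous.
exact: rV_linear_continuous.
Qed.

Lemma rV_sphere_compact {R : realType} n :
  compact [set v : 'rV[R]_n | `|v| = 1].
Proof.
apply: bounded_closed_compact.
  by exists 1; split => // r r1 v /= ->; exact: ltW.
have := @closed_comp _ _ (fun v : 'rV[R]_n => `|v|) [set 1 : R].
apply; first by move=> v _; exact: norm_continuous.
exact: closed_eq.
Qed.

Section DualNorm.
Context {R : realType} {E : normedVectType R}.
Implicit Types (p : dual E) (x : E).

Lemma dualZ p (a : R) x : p (a *: x) = a * p x. Proof. exact: linearZ. Qed.

Lemma dualB p x y : p (x - y) = p x - p y. Proof. exact: linearB. Qed.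

Lemma dual_zeroE x : (0 : dual E) x = 0 :> R. Proof. by rewrite lfunE. Qed.

Lemma dual_subE p q x : (p - q) x = p x - q x.
Proof. by rewrite !lfunE /= lfunE. Qed.

Lemma dual_scaleE (a : R) p x : (a *: p) x = a * p x.
Proof. by rewrite lfunE. Qed.

(** The norm of [E], read in coordinates, is continuous and positive on the unit
    sphere of ['rV_(dim E)], hence bounded below there by some [c > 0]; any
    bound [C] for the form in coordinates then gives the bound [C / c]. *)
Lemma dual_bounded p : exists C : R, forall x, p x <= C * `|x|.
Proof.
pose S := [set v : 'rV[R]_(dim E) | `|v| = 1].
pose q : {linear 'rV[R]_(dim E) -> R^o} := p \o r2v.
(* The sphere is empty exactly when [dim E = 0]. *)
have [S0|S0] := pselect (S !=set0); last first.
  exists 0 => x; rewrite mul0r.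
  have [->|x0] := eqVneq x 0; first by rewrite linear0.
  exfalso; apply: S0; exists (`|v2r x|^-1 *: v2r x).
  have vx0 : v2r x != 0.
    by apply: contra x0 => /eqP/(congr1 r2v); rewrite v2rK linear0 => ->.
  by rewrite /S /= normrZ normfV normr_id mulVf// normr_eq0.
have cN := @rV_linear_norm_continuous _ E _ r2v.
have [c cS cmin] := compact_EVT_min S0 (@rV_sphere_compact _ _)
  (continuous_subspaceT cN).
have c0 : 0 < `|r2v c : E|.
  rewrite normr_gt0; apply/eqP => /(congr1 v2r); rewrite r2vK linear0 => c0.
  by move: cS; rewrite inE c0 /S /= normr0 => /esym/eqP; rewrite oner_eq0.
have [C C0 qC] := rV_linear_bounded q.
exists (C / `|r2v c : E|) => x.
have -> : p x = q (v2r x) by rewrite /q /= v2rK.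
apply: (le_trans (ler_norm _)); apply: (le_trans (qC _)).
rewrite -mulrA ler_wpM2l// mulrC ler_pdivlMr//.
have [->|vx0] := eqVneq (v2r x) 0; first by rewrite normr0 mul0r.
have nv : 0 < `|v2r x| by rewrite normr_gt0.
have := cmin (`|v2r x|^-1 *: v2r x).
rewrite inE /S /= linearZ /= v2rK !normrZ normfV normr_id.
rewrite mulVf ?gt_eqF// => /(_ erefl).
by rewrite mulrC ler_pdivlMr// mulrC.
Qed.

Lemma dual_norm_has_sup p :
  has_sup [set (p x : R) | x in [set x : E | `|x| <= 1]].
Proof.
split; first by exists (p 0), 0 => //=; rewrite normr0.
have [C pC] := dual_bounded p.
exists `|C| => _ [x /= x1 <-]; apply: (le_trans (pC x)).
apply: (le_trans (ler_norm _)); rewrite normrM normr_id.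
by rewrite ler_piMr.
Qed.

Lemma dual_norm_ub p x : `|x| <= 1 -> p x <= dual_norm p.
Proof. by move=> x1; apply: (sup_upper_bound (dual_norm_has_sup p)); exists x. Qed.

Lemma dual_norm_le p (C : R) :
  (forall x, `|x| <= 1 -> p x <= C) -> dual_norm p <= C.
Proof.
move=> pC; apply: sup_le_ub; first by have [] := dual_norm_has_sup p.
by move=> _ [x /= x1 <-]; exact: pC.
Qed.

Lemma dual_pairing_le p x : p x <= dual_norm p * `|x|.
Proof.
have [->|x0] := eqVneq x 0; first by rewrite linear0 normr0 mulr0.
have nx : 0 < `|x| by rewrite normr_gt0.
have := @dual_norm_ub p (`|x|^-1 *: x).
rewrite normrZ normfV normr_id mulVf ?gt_eqF// => /(_ (lexx _)).
by rewrite linearZ /= -ler_pdivrMr// mulrC.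
Qed.

Lemma dual_norm_gt0 p : p != 0 -> 0 < dual_norm p.
Proof.
move=> p0; rewrite ltNge; apply: contra p0 => pn.
apply/eqP/lfunP => x; rewrite lfunE /=.
have pxN y : p y <= 0.
  by apply: (le_trans (dual_pairing_le p y)); rewrite mulr_le0_ge0.
by apply/eqP; rewrite eq_le pxN /= -oppr_le0 -linearN pxN.
Qed.
End DualNorm.

(** * Convex combinations *)

Section Jensen.
Context {R : realType} {E : normedVectType R}.
Implicit Types (X : set E) (f : E -> R).

Lemma convex_set_comb X (t : R) a b : convex_set X -> 0 <= t <= 1 ->
  X a -> X b -> X (t *: a + (1 - t) *: b).
Proof.
move=> X_convex /andP [t0 t1] Xa Xb.
by have := @X_convex a b (Itv01 t0 t1); rewrite !inE; apply.
Qed.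

Lemma convex_function_comb X f (t : R) a b :
  convex_function X f -> 0 <= t <= 1 -> X a -> X b ->
  f (t *: a + (1 - t) *: b) <= t * f a + (1 - t) * f b.
Proof.
move=> f_convex /andP [t0 t1] Xa Xb.
by have := f_convex (Itv01 t0 t1) a b; rewrite !inE; apply.
Qed.

Lemma sum_weights_eq0 {I : Type} {V : nmodType} (r : seq I) (P : pred I)
    (w : I -> R) (F : I -> V) : (forall i, P i -> 0 < w i) ->
  \sum_(i <- r | P i) w i = 0 -> \sum_(i <- r | P i) F i = 0.
Proof.
move=> w0; elim: r => [|i r IH]; first by rewrite !big_nil.
rewrite !big_cons; case: ifPn => // Pi sw0.
have : 0 < w i + \sum_(j <- r | P j) w j.
  by rewrite ltr_wpDr ?w0// sumr_ge0// => j /w0/ltW.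
by rewrite sw0 ltxx.
Qed.

(** Jensen's inequality for weights that are positive but not normalized; the
    barycentre does not depend on the function, so all convex functions are
    treated at once. *)
Lemma jensen {I : Type} (r : seq I) (P : pred I) (w : I -> R) (z : I -> E) X :
  convex_set X -> (forall i, P i -> 0 < w i) -> (forall i, P i -> X (z i)) ->
  let W := \sum_(i <- r | P i) w i in
  let c := W^-1 *: \sum_(i <- r | P i) w i *: z i in
  0 < W -> X c /\ forall f, convex_function X f ->
    f c <= W^-1 * \sum_(i <- r | P i) w i * f (z i).
Proof.
move=> X_convex w0 Xz /=.
elim: r => [|i r IH]; first by rewrite big_nil ltxx.
rewrite !big_cons; case: ifPn => [Pi|/negbTE nPi]; last first.
  move=> /IH [Xc fc]; split=> // f f_convex.
  by rewrite big_cons nPi; exact: fc.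
set W := \sum_(j <- r | P j) w j in IH *.
set S := \sum_(j <- r | P j) w j *: z j in IH *.
have W_ge0 : 0 <= W by apply: sumr_ge0 => j /w0/ltW.
have wi := w0 i Pi.
have Xi := Xz i Pi.
(* If [W = 0], all terms after [i] are filtered out and the barycentre is [z i].
   Otherwise it is a combination of [z i] and the barycentre of the tail. *)
have [W0|W_neq0] := eqVneq W 0.
  rewrite W0 [S](sum_weights_eq0 _ w0 W0) !addr0 scalerA mulVf ?gt_eqF// scale1r.
  move=> _; split=> // f _; rewrite big_cons Pi (sum_weights_eq0 _ w0 W0) addr0.
  by rewrite mulrA mulVf ?gt_eqF// mul1r.
have W_gt0 : 0 < W by rewrite lt_neqAle eq_sym W_neq0.
have [Xc fc] := IH W_gt0 => _.
pose t := w i / (w i + W).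
have wW : 0 < w i + W by rewrite addr_gt0.
have t01 : 0 <= t <= 1.
  apply/andP; split; first by apply: divr_ge0; exact: ltW.
  by rewrite ler_pdivrMr// mul1r lerDl.
have -> : (w i + W)^-1 *: (w i *: z i + S) = t *: z i + (1 - t) *: (W^-1 *: S).
  rewrite scalerDr !scalerA /t; congr (_ *: _ + _ *: _); first exact: mulrC.
  by field; rewrite !gt_eqF.
split; first exact: convex_set_comb.
move=> f f_convex; rewrite big_cons Pi.
apply: (le_trans (convex_function_comb f_convex t01 Xi Xc)).
have t1 : 0 <= 1 - t by case/andP: t01; lra.
apply: (le_trans (lerD (lexx _) (ler_wpM2l t1 (fc f f_convex)))).
suff -> : t * f (z i) + (1 - t) * (W^-1 * \sum_(j <- r | P j) w j * f (z j)) =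
    (w i + W)^-1 * (w i * f (z i) + \sum_(j <- r | P j) w j * f (z j)) by [].
by rewrite /t; field; rewrite !gt_eqF.
Qed.
End Jensen.

(** * Relative derivatives on the unit interval *)

(** [dphi] is the derivative of [phi] on [[0, 1]], relative to that interval: at
    the end points only one-sided increments are constrained, and values
    outside of [[0, 1]] play no role. *)
Definition unit_derivative {R : realType} (phi dphi : R -> R) : Prop :=
  forall s : R, 0 <= s <= 1 -> forall e : R, 0 < e ->
    \forall t \near s, 0 <= t <= 1 ->
      `|phi t - phi s - (t - s) * dphi s| <= e * `|t - s|.

Section UnitDerivative.
Context {R : realType}.
Implicit Types phi dphi : R -> R.

Lemma unit_derivative_ge0 phi dphi : unit_derivative phi dphi ->
  (forall t, 0 <= t <= 1 -> phi 0 <= phi t) -> 0 <= dphi 0.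
Proof.
move=> dp pmin; rewrite leNgt; apply/negP => d0.
have e0 : 0 < - dphi 0 / 2 by lra.
have := dp 0; rewrite lexx ler01 => /(_ isT _ e0) /nbhs_ballP [r /= r0 rP].
(* A small [t] at which [phi t <= phi 0 + t * dphi 0 / 2 < phi 0]. *)
pose t : R := Num.min (r / 2) 1.
have t0 : 0 < t by rewrite lt_min; apply/andP; split; lra.
have t1 : t <= 1 by rewrite ge_min lexx orbT.
have tr : t < r by rewrite (@le_lt_trans _ _ (r/2)) ?ge_min ?lexx//; lra.
have := rP t; rewrite /ball /= sub0r normrN gtr0_norm// => /(_ tr).
rewrite (ltW t0) t1 => /(_ isT).
rewrite subr0 (gtr0_norm t0) => /ler_normlP [_].
have := pmin t; rewrite (ltW t0) t1 => /(_ isT).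
have : 0 < t * (- dphi 0) by apply: mulr_gt0 => //; lra.
lra.
Qed.

Lemma unit_derivative_MVT phi dphi : unit_derivative phi dphi ->
  exists2 c, 0 < c < 1 & phi 1 - phi 0 = dphi c.
Proof.
move=> dp.
have [||| c cI] := @MVT R phi dphi 0 1.
- exact: ltr01.
- move=> s; rewrite in_itv /= => /andP [s0 s1].
  have cvg : h^-1 *: (phi (h *: (1 : R) + s) - phi s) @[h --> 0^'] --> dphi s.
    apply/cvgrPdist_le => e e0.
    have := dp s; rewrite !ltW// => /(_ isT _ e0) /nbhs_ballP [r /= r0 rP].
    (* The increment must keep the point inside [[0, 1]]. *)
    pose r' := Num.min r (Num.min s (1 - s)).
    have r'0 : 0 < r' by rewrite !lt_min r0 s0 subr_gt0.
    apply/nbhs_ballP; exists r' => //= h; rewrite /ball /= sub0r normrN => hr h0.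
    move: hr; rewrite !lt_min => /and3P [hr hs hs1].
    have := rP (h + s); rewrite /ball /= opprD addrCA addrN addr0 normrN => /(_ hr).
    move: hs hs1 => /ltr_normlP [? ?] /ltr_normlP [? ?].
    have -> : 0 <= h + s <= 1 by apply/andP; split; lra.
    move=> /(_ isT); rewrite addrK => bnd.
    rewrite -[h *: 1]/(h * 1) mulr1 -[_ *: _]/(_ * _).
    have -> : dphi s - h^-1 * (phi (h + s) - phi s) =
        - (h^-1 * (phi (h + s) - phi s - h * dphi s)) by field.
    by rewrite normrN normrM normfV ler_pdivrMl ?normr_gt0// [leRHS]mulrC.
  have dv : derivable phi s 1 by exact: (cvgP _ cvg).
  by apply: (DeriveDef dv); exact: cvg_lim.
- apply/subspace_continuousP => s /=; rewrite in_itv /= => s01.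
  apply/cvgrPdist_le => e e0.
  have D0 : 0 < 1 + `|dphi s| by rewrite ltr_wpDr.
  have := dp s s01 1 ltr01 => /nbhs_ballP [r /= r0 rP].
  apply/nbhs_ballP; exists (Num.min r (e / (1 + `|dphi s|))).
    by rewrite /= lt_min r0 divr_gt0.
  move=> t; rewrite /ball /= lt_min distrC => /andP [tr te] t01.
  move: t01; rewrite in_itv /= => t01.
  have := rP t; rewrite /ball /= distrC => /(_ tr t01); rewrite mul1r => bnd.
  have := ler_normD (phi t - phi s - (t - s) * dphi s) ((t - s) * dphi s).
  rewrite subrK normrM distrC => H; rewrite (le_trans H)//.
  move/ltW: te; rewrite ler_pdivlMr// => te.
  by rewrite (le_trans _ te)// mulrDr mulr1 lerD2r.
- by rewrite subr0 mulr1 => eq; exists c => //; rewrite in_itv in cI.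
Qed.

Lemma unit_derivative_quadratic phi dphi (b c : R) : unit_derivative phi dphi ->
  (forall s, 0 < s < 1 -> b + c * s <= dphi s) ->
  b + c / 2 <= phi 1 - phi 0.
Proof.
move=> dp dlow.
(* The mean value theorem applies to [phi] minus the quadratic it dominates. *)
pose psi t := phi t - (b * t + c / 2 * t ^+ 2).
pose dpsi t := dphi t - (b + c * t).
have dpsiP : unit_derivative psi dpsi.
  move=> s s01 e e0.
  have D0 : 0 < 1 + `|c / 2| by rewrite ltr_wpDr.
  have e20 : 0 < e / 2 by lra.
  have := dp s s01 _ e20 => /nbhs_ballP [r /= r0 rP].
  apply/nbhs_ballP; exists (Num.min r (e / 2 / (1 + `|c / 2|))).
    by rewrite /= lt_min r0 divr_gt0.
  move=> t; rewrite /ball /= lt_min distrC => /andP [tr te] t01.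
  have := rP t; rewrite /ball /= distrC => /(_ tr t01) bnd.
  have -> : psi t - psi s - (t - s) * dpsi s =
    (phi t - phi s - (t - s) * dphi s) - c / 2 * (t - s) * (t - s).
    by rewrite /psi /dpsi; field.
  apply: (le_trans (ler_normB _ _)).
  have -> : e * `|t - s| = e / 2 * `|t - s| + e / 2 * `|t - s| by field.
  apply: lerD => //; rewrite normrM ler_wpM2r//.
  move/ltW: te; rewrite ler_pdivlMr// => te.
  by rewrite (le_trans _ te)// normrM mulrC mulrDr mulr1 lerDr.
have [s s01] := unit_derivative_MVT dpsiP.
have := dlow s s01; rewrite /psi /dpsi; lra.
Qed.
End UnitDerivative.

(** * Bregman divergence and mirror steps *)

Section Segment.
Context {R : realType} {E : normedVectType R} {X : set E}.
Context {d : E -> R} {gd : E -> dual E}.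
Hypothesis X_convex : convex_set X.
Hypothesis d_C1 : continuously_differentiable_on X d gd.

Lemma convex_segment a b (t : R) : X a -> X b -> 0 <= t <= 1 ->
  X (a + t *: (b - a)).
Proof.
move=> Xa Xb t01.
have -> : a + t *: (b - a) = t *: b + (1 - t) *: a.
  by rewrite scalerBl scale1r scalerBr addrCA.
exact: convex_set_comb.
Qed.

(** The linear form [q] is included so that the objective of a mirror step,
    which is [d] plus a linear form up to a constant, is covered. *)
Lemma unit_derivative_segment (q : dual E) a b : X a -> X b ->
  unit_derivative (fun t : R => q (a + t *: (b - a)) + d (a + t *: (b - a)))
    (fun t : R => q (b - a) + gd (a + t *: (b - a)) (b - a)).
Proof.
move=> Xa Xb s s01 e e0.
pose z (t : R) : E := a + t *: (b - a).
have [/(_ (z s) (convex_segment Xa Xb s01)) dz _] := d_C1.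
have K0 : 0 < 1 + `|b - a| by rewrite ltr_wpDr.
have eK : 0 < e / (1 + `|b - a|) by exact: divr_gt0.
have zB t : z t - z s = (t - s) *: (b - a).
  by rewrite /z opprD addrACA subrr add0r scalerBl.
have cz : z t @[t --> s] --> z s.
  apply: cvgD; first exact: cvg_cst.
  by apply: cvgZr_tmp => //; exact: cvg_id.
have H : nbhs (z s) [set y : E | X y ->
    `|d y - d (z s) - gd (z s) (y - z s)| <= e / (1 + `|b - a|) * `|y - z s| ].
  by move/eqoP: dz => /(_ _ eK).
have H1 : \forall t \near s, X (z t) ->
    `|d (z t) - d (z s) - gd (z s) (z t - z s)| <=
      e / (1 + `|b - a|) * `|z t - z s| by exact: (cz _ H).
near=> t => t01.
have := near H1 t; rewrite zB => H2.
have : `|d (z t) - d (z s) - gd (z s) ((t - s) *: (b - a))| <=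
    e / (1 + `|b - a|) * `|(t - s) *: (b - a)|.
  by apply: H2 => //; exact: convex_segment.
rewrite -!/(z _).
have -> : q (z t) + d (z t) - (q (z s) + d (z s))
    - (t - s) * (q (b - a) + gd (z s) (b - a)) =
    d (z t) - d (z s) - gd (z s) ((t - s) *: (b - a)).
  by have := congr1 q (zB t); rewrite !dualZ dualB; lra.
move=> /le_trans; apply; rewrite normrZ mulrA mulrAC ler_wpM2r//.
by rewrite mulrAC ler_pdivrMr// ler_pM2l// lerDr.
Unshelve. all: by end_near.
Qed.

Lemma argmin_first_order (q : dual E) u v :
  is_argmin X (fun w => q w + d w) u -> X v -> 0 <= q (v - u) + gd u (v - u).
Proof.
move=> [Xu umin] Xv.
have := unit_derivative_ge0 (unit_derivative_segment q Xu Xv).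
rewrite scale0r addr0; apply=> t t01.
by apply: umin; exact: convex_segment.
Qed.

Hypothesis d_sc : strongly_convex1_on X gd.

Lemma bregman_ge u v : X u -> X v -> `|v - u| ^+ 2 / 2 <= bregman d gd u v.
Proof.
move=> Xu Xv.
(* On the segment, strong monotonicity makes the derivative at [s] at least
   [gd u (v - u) + s * |v - u|^2]. *)
have := unit_derivative_quadratic (b := gd u (v - u)) (c := `|v - u| ^+ 2)
  (unit_derivative_segment 0 Xu Xv).
rewrite scale0r addr0 scale1r addrCA subrr addr0 !dual_zeroE !add0r => H.
suff : gd u (v - u) + `|v - u| ^+ 2 / 2 <= d v - d u by rewrite /bregman; lra.
apply: H => s /andP [s0 s1]; rewrite add0r.
have s01 : 0 <= s <= 1 by rewrite !ltW.
have := d_sc (convex_segment Xu Xv s01) Xu.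
rewrite addrC addrA addNr add0r normrZ (gtr0_norm s0) dualZ dual_subE.
rewrite exprMn expr2 -mulrA ler_pM2l//; lra.
Qed.

(** One step of the method against an arbitrary [v] in [X]: adding the
    optimality condition of [u], the quadratic lower bound on [V(x, u)] and
    [h |p| |x - u| <= h^2 |p|^2 / 2 + |x - u|^2 / 2]. *)
Lemma mirror_step (h : R) (p : dual E) x u v : 0 <= h -> X x -> X v ->
  is_mirr X d gd x (h *: p) u ->
  h * p (x - v) <=
    h ^+ 2 * dual_norm p ^+ 2 / 2 + bregman d gd x v - bregman d gd u v.
Proof.
move=> h0 Xx Xv [Xu umin].
have umin' : is_argmin X (fun w => (h *: p - gd x) w + d w) u.
  split=> // w Xw; have := umin w Xw.
  by rewrite /bregman !dual_subE !dual_scaleE !dualB; lra.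
have := argmin_first_order umin' Xv.
rewrite dual_subE dual_scaleE => opt.
have := bregman_ge Xx Xu.
have hp := ler_wpM2l h0 (dual_pairing_le p (x - u)).
(* Young's inequality for the product [h |p| |u - x|] *)
have : 0 <= (h * dual_norm p - `|u - x|) ^+ 2 by exact: sqr_ge0.
move: opt hp; rewrite /bregman (distrC x u) !dualB.
lra.
Qed.
End Segment.

(** * Subgradients at interior points *)

(** The hypothesis [p != 0] forces [0 < L]; on a trivial space, where [p = 0],
    even a negative [L] is a Lipschitz constant. *)
Lemma interior_lipschitz_dual_norm {R : realType} {E : normedVectType R}
    (X : set E) (f : E -> R) (L : R) x (p : dual E) :
  L.-lipschitz_X f -> interior X x -> is_subgradient X f x p -> p != 0 ->
  dual_norm p <= L.
Proof.
move=> f_lip /nbhs_ballP [r /= r0 rX] sub p0.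
have Xx : X x by apply: rX; exact: ballxx.
have pL z : p z <= L * `|z|.
  have [->|z0] := eqVneq z 0; first by rewrite linear0 normr0 mulr0.
  have nz : 0 < `|z| by rewrite normr_gt0.
  (* A scaling of [z] that keeps [x + t z] within distance [r / 2] of [x]. *)
  pose t : R := r / 2 / `|z|.
  have t0 : 0 < t by rewrite !divr_gt0.
  have Xy : X (x + t *: z).
    apply: rX; rewrite -ball_normE /ball_ /= opprD addrA subrr add0r normrN normrZ.
    by rewrite (gtr0_norm t0) divfK ?gt_eqF//; lra.
  have := f_lip (x + t *: z, x) (conj Xy Xx).
  rewrite /self_sub /= addrAC subrr add0r.
  have := sub _ Xy; rewrite addrAC subrr add0r dualZ normrZ (gtr0_norm t0) => H1 H2.
  rewrite -(ler_pM2l t0) mulrCA; have := ler_norm (f (x + t *: z) - f x); lra.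
have L0 : 0 < L.
  rewrite ltNge; apply/negP => L0.
  have := dual_norm_gt0 p0; rewrite ltNge => /negP; apply.
  by apply: dual_norm_le => z _; apply: (le_trans (pL z)); rewrite mulr_le0_ge0.
by apply: dual_norm_le => z z1; apply: (le_trans (pL z)); rewrite ler_piMr// ltW.
Qed.

(** * Analysis of a run *)

Section Run.
Context {R : realType} {E : normedVectType R} {M : nat} {X : set E}.
Context {f : E -> R} {g : 'I_M.+1 -> E -> R}.
Context {d : E -> R} {gd : E -> dual E} {Theta0 eps : R} {xs : E}.
Hypothesis X_convex : convex_set X.
Hypothesis d_C1 : continuously_differentiable_on X d gd.
Hypothesis d_sc : strongly_convex1_on X gd.
Hypothesis eps_gt0 : 0 < eps.
Context {x : nat -> E} {p : nat -> dual E} {m : nat -> 'I_M.+1} {N : nat}.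
Hypothesis run : algorithm_run X d gd f g eps Theta0 x p m N.

Lemma run_mem k : (k <= N)%N -> X (x k).
Proof.
case: k => [_|k kN]; first by have [] := run_start run.
by have [] := run_step run kN.
Qed.

Lemma step_size_gt0 k : (k < N)%N -> 0 < step_size eps (p k).
Proof.
by move=> kN; rewrite divr_gt0// exprn_gt0// dual_norm_gt0// (run_nonzero run).
Qed.

(** Telescoped sum of the mirror steps. *)
Lemma run_regret v n : X v -> (n <= N)%N ->
  \sum_(k < n) step_size eps (p k) * p k (x k - v) <=
    eps ^+ 2 / 2 * (\sum_(k < n) (dual_norm (p k) ^+ 2)^-1)
    + bregman d gd (x 0%N) v - bregman d gd (x n) v.
Proof.
move=> Xv; elim: n => [|n IH] nN; first by rewrite !big_ord0; lra.
rewrite !big_ord_recr /=.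
have := IH (ltnW nN).
have := mirror_step X_convex d_C1 d_sc (ltW (step_size_gt0 nN))
  (run_mem (ltnW nN)) Xv (run_step run nN).
have -> : step_size eps (p n) ^+ 2 * dual_norm (p n) ^+ 2 / 2
  = eps ^+ 2 / 2 * (dual_norm (p n) ^+ 2)^-1.
  rewrite /step_size; field.
  by rewrite gt_eqF// dual_norm_gt0// (run_nonzero run).
lra.
Qed.

Lemma bregman_start_le v : X v -> bregman d gd (x 0%N) v <= d v - d (x 0%N).
Proof.
move=> Xv.
have x0min : is_argmin X (fun w => (0 : dual E) w + d w) (x 0%N).
  have [X0 dmin] := run_start run.
  by split => // w Xw; rewrite !dual_zeroE !add0r; exact: dmin.
have := argmin_first_order X_convex d_C1 x0min Xv.
by rewrite dual_zeroE /bregman; lra.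
Qed.

(** Under the stopping criterion, the weighted average of [<p_k, x_k - xs>]
    over all steps, productive or not, is at most [eps]. *)
Lemma run_excess_le0 : X xs -> 0 <= d (x 0%N) -> d xs <= Theta0 ^+ 2 ->
  stopping eps Theta0 p N ->
  \sum_(k < N) step_size eps (p k) * (p k (x k - xs) - eps) <= 0.
Proof.
move=> Xxs d0 dxs; rewrite /stopping ler_pdivrMr ?exprn_gt0// => stop.
have wE : \sum_(k < N) step_size eps (p k) * eps =
    eps ^+ 2 * \sum_(k < N) (dual_norm (p k) ^+ 2)^-1.
  rewrite mulr_sumr; apply: eq_bigr => k _.
  by rewrite /step_size expr2 mulrAC.
under eq_bigr do rewrite mulrBr.
rewrite sumrB wE.
have := run_regret Xxs (leqnn N).
have := bregman_start_le Xxs.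
have := bregman_ge X_convex d_C1 d_sc (run_mem (leqnn N)) Xxs.
have : 0 <= `|xs - x N| ^+ 2 by exact: sqr_ge0.
move: stop; lra.
Qed.

Lemma productive_gap k : (k < N)%N -> X xs -> productive g eps (x k) ->
  f (x k) - f xs <= p k (x k - xs).
Proof.
move=> kN Xxs pk; have := run_productive run kN pk Xxs.
by rewrite !dualB; lra.
Qed.

Lemma nonproductive_gap k : (k < N)%N -> X xs -> (forall i, g i xs <= 0) ->
  ~~ productive g eps (x k) -> eps < p k (x k - xs).
Proof.
move=> kN Xxs gxs npk; have [epsg /(_ _ Xxs)] := run_nonproductive run kN npk.
by have := gxs (m k); rewrite !dualB; lra.
Qed.

Lemma total_weight_gt0 : X xs -> (forall i, g i xs <= 0) -> (0 < N)%N ->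
  \sum_(k < N) step_size eps (p k) * (p k (x k - xs) - eps) <= 0 ->
  0 < total_weight g eps x p N.
Proof.
move=> Xxs gxs N0 excess.
case: (boolP [exists k : 'I_N, productive g eps (x k)]) => [/existsP [k pk]|].
  rewrite /total_weight (bigD1 k)//= ltr_wpDr ?step_size_gt0//.
  by apply: sumr_ge0 => i _; apply: ltW; exact: step_size_gt0.
(* Without a productive step, every term of the sum would be positive. *)
rewrite negb_exists => /forallP np; exfalso.
move: excess; rewrite leNgt => /negP; apply.
have sum0 : \sum_(k < N) (0 : R) = 0 by rewrite big1.
rewrite -[ltLHS]sum0; apply: ltr_sum => [|k _].
  by apply/hasP; exists (Ordinal N0); rewrite ?mem_index_enum.
by rewrite mulr_gt0 ?step_size_gt0// subr_gt0 nonproductive_gap.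
Qed.

Lemma productive_excess_le0 : X xs -> (forall i, g i xs <= 0) ->
  \sum_(k < N) step_size eps (p k) * (p k (x k - xs) - eps) <= 0 ->
  \sum_(k < N | productive g eps (x k))
     step_size eps (p k) * (f (x k) - f xs - eps) <= 0.
Proof.
move=> Xxs gxs; rewrite (bigID (fun k : 'I_N => productive g eps (x k))) /=.
apply: le_trans; rewrite -[leLHS]addr0; apply: lerD.
  apply: ler_sum => k pk; rewrite ler_pM2l ?step_size_gt0// lerD2r.
  exact: productive_gap.
apply: sumr_ge0 => k npk; apply: mulr_ge0; first exact/ltW/step_size_gt0.
by rewrite subr_ge0 ltW// nonproductive_gap.
Qed.

End Run.

Lemma le_gmax {R : realType} {E : normedVectType R} M
    (g : 'I_M.+1 -> E -> R) i x :
  g i x <= gmax g x.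
Proof. exact: le_bigmax. Qed.

Lemma gmax_le {R : realType} {E : normedVectType R} M
    (g : 'I_M.+1 -> E -> R) x c :
  (forall i, g i x <= c) -> gmax g x <= c.
Proof. by move=> gc; apply: bigmax_le. Qed.

Theorem theorem1 (R : realType) (E : normedVectType R) (M : nat)
    (X : set E) (f : E -> R) (g : 'I_M.+1 -> E -> R) (Mf Mg : R)
    (d : E -> R) (gd : E -> dual E) (Theta0 eps : R) (xs : E)
    (X_closed : closed X) (X_convex : convex_set X)
    (f_convex : convex_function X f)
    (f_subdiff : subdifferentiable_on X f)
    (f_lipschitz : Mf.-lipschitz_X f)
    (g_convex : forall m, convex_function X (g m))
    (g_subdiff : forall m, subdifferentiable_on X (g m))
    (g_lipschitz : forall m, Mg.-lipschitz_X (g m))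
    (d_C1 : continuously_differentiable_on X d gd)
    (d_strongly_convex : strongly_convex1_on X gd)
    (d_min : is_argmin X d 0)
    (d_normalized : 0 <= d 0)
    (xs_solution : is_solution X f g xs)
    (Theta0_gt0 : 0 < Theta0) (d_xs : d xs <= Theta0 ^+ 2)
    (eps_gt0 : 0 < eps)
    (x : nat -> E) (p : nat -> dual E) (m : nat -> 'I_M.+1) (N : nat)
    (run : algorithm_run X d gd f g eps Theta0 x p m N) :
  (stopping eps Theta0 p N ->
     [/\ 0 < total_weight g eps x p N,
         X (output g eps x p N),
         f (output g eps x p N) - f xs <= eps &
         gmax g (output g eps x p N) <= eps])
  /\
  ((forall k, (k < N)%N -> ~ interior X (x k) ->
      dual_norm (p k) <= if productive g eps (x k) then Mf else Mg) ->
   (N%:Z <= Num.ceil (2 * Num.max (Mf ^+ 2) (Mg ^+ 2) * Theta0 ^+ 2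
                      / eps ^+ 2))%R).
Proof.
have [[X0 _] [[Xxs gxs] _]] := (d_min, xs_solution).
split => [stop|dual_bound].
  have x0_ge0 : 0 <= d (x 0%N).
    apply: (le_trans d_normalized); case: d_min => _; apply.
    exact: (run_mem run).
  have N0 : (0 < N)%N.
    case: N stop {run} => // ; rewrite /stopping big_ord0 leNgt => /negP[].
    by rewrite divr_gt0 ?mulr_gt0 ?exprn_gt0.
  have excess := run_excess_le0 X_convex d_C1 d_strongly_convex eps_gt0 run
    Xxs x0_ge0 d_xs stop.
  have W_gt0 := total_weight_gt0 eps_gt0 run Xxs gxs N0 excess.
  have [Xout out_le] := jensen (r := index_enum 'I_N)
    (P := fun k : 'I_N => productive g eps (x k))
    (w := fun k => step_size eps (p k)) (z := fun k => x k) X_convex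
    (fun k _ => step_size_gt0 eps_gt0 run (ltn_ord k))
    (fun k _ => run_mem run (ltnW (ltn_ord k))) W_gt0.
  split => //.
    have := productive_excess_le0 eps_gt0 run Xxs gxs excess.
    have -> : \sum_(k < N | productive g eps (x k))
        step_size eps (p k) * (f (x k) - f xs - eps) =
      \sum_(k < N | productive g eps (x k)) step_size eps (p k) * f (x k)
        - total_weight g eps x p N * (f xs + eps).
      rewrite /total_weight mulr_suml -sumrB; apply: eq_bigr => k _.
      by rewrite -mulrBr opprD addrA.
    rewrite subr_le0 -ler_pdivrMl// => /(le_trans (out_le f f_convex)).
    by rewrite lerBlDl.
  apply: gmax_le => i; apply: (le_trans (out_le (g i) (g_convex i))).
  rewrite ler_pdivrMl// mulr_suml; apply: ler_sum => k pk.
  rewrite ler_pM2l ?(step_size_gt0 eps_gt0 run)//.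
  exact: (le_trans (le_gmax g i (x k))).
(* The criterion fails at [N - 1]; the case [N = 0] only needs a nonnegative
   ceiling. *)
have [->|] := posnP N.
  rewrite ceil_ge0; apply: (lt_le_trans (ltrN10 _)).
  apply: divr_ge0; last exact: sqr_ge0.
  by rewrite mulr_ge0 ?sqr_ge0// mulr_ge0// le_max sqr_ge0.
case: N run dual_bound => // n run dual_bound _.
rewrite -addn1 PoszD lezD1 ceil_gt_int.
set K := Num.max (Mf ^+ 2) (Mg ^+ 2).
have p_le k : (k < n.+1)%N -> dual_norm (p k) ^+ 2 <= K.
  move=> kn.
  have pk : dual_norm (p k) <= if productive g eps (x k) then Mf else Mg.
    have [inX|] := pselect (interior X (x k)); last exact: dual_bound.
    have pk0 := run_nonzero run kn.
    case: ifPn => prod.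
      have sub := run_productive run kn prod.
      exact: (interior_lipschitz_dual_norm f_lipschitz inX sub pk0).
    have [_ sub] := run_nonproductive run kn prod.
    exact: (interior_lipschitz_dual_norm (g_lipschitz (m k)) inX sub pk0).
  have p0 := dual_norm_gt0 (run_nonzero run kn).
  rewrite /K le_max; move: pk; case: ifPn => _ pk; apply/orP; [left|right];
  by rewrite lerXn2r ?nnegrE// ?ltW// (lt_le_trans p0).
have K0 : 0 < K.
  apply: lt_le_trans (p_le 0%N isT).
  by rewrite exprn_gt0// dual_norm_gt0// (run_nonzero run).
have := run_continue run (ltnSn n).
rewrite /stopping => /negP; rewrite -ltNge => lt.
have : n%:R / K <= \sum_(j < n) (dual_norm (p j) ^+ 2)^-1.
  rewrite mulr_natl -[n in leLHS]card_ord -sumr_const; apply: ler_sum => j _.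
  have jn : (j < n.+1)%N by exact: ltnW (ltn_ord j).
  by rewrite lef_pV2 ?posrE ?p_le// exprn_gt0// dual_norm_gt0// (run_nonzero run).
move=> /le_lt_trans/(_ lt); rewrite ltr_pdivrMr//.
suff -> : 2 * Theta0 ^+ 2 / eps ^+ 2 * K = 2 * K * Theta0 ^+ 2 / eps ^+ 2 by [].
by ring.
Qed.
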